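(* Let $k\ge 2$, let $(X_i,d_i)$, $1\le i\le k$, be compact metric spaces with continuous maps $T_i:X_i\to X_i$, and let $\pi_i:X_i\to X_{i+1}$ $(1\le i\le k-1)$ be factor maps, i.e. continuous maps with $\pi_i\circ T_i=T_{i+1}\circ\pi_i$. Let $\mathbf a=(a_1,\dots,a_k)\in\mathbb R^k$ with $a_1>0$ and $a_i\ge 0$ for $2\le i\le k$. If $(X_1,T_1)$ has the small boundary property, then its $\mathbf a$-weighted mean dimension vanishes: $\mathrm{mdim}^{\mathbf a}(X_1,T_1)=0$.
   Context: Notation: $\pi_0=\mathrm{id}_{X_1}$ and $\tau_i=\pi_i\circ\pi_{i-1}\circ\cdots\circ\pi_0:X_1\to X_{i+1}$ for $0\le i\le k-1$. $\lceil u\rceil$ is the least integer $\ge u$. Covers: for finite open covers $\alpha,\beta$ of a compact metric space $X$, $\beta\succ\alpha$ ($\beta$ refines $\alpha$) means every member of $\beta$ is contained in some member of $\alpha$; $\alpha\vee\beta=\{U\cap V:U\in\alpha,V\in\beta\}$; for a continuous map $f$, $f^{-1}\alpha=\{f^{-1}(U):U\in\alpha\}$. Put $\mathrm{ord}(\alpha)=\max_{x\in X}\sum_{U\in\alpha}1_U(x)-1$ and $D(\alpha)=\min_{\beta\succ\alpha}\mathrm{ord}(\beta)$, where $\beta$ runs over all finite open covers of $X$ refining $\alpha$. Weighted mean dimension: $$\mathrm{mdim}^{\mathbf a}(X_1,T_1)=\sup_{\alpha_1,\dots,\alpha_k}\limsup_{n\to\infty}\frac1n D\Big(\bigvee_{i=1}^{k}\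 \bigvee_{j=0}^{\lceil(a_1+\cdots+a_i)n\rceil-1}T_1^{-j}\tau_{i-1}^{-1}\alpha_i\Big),$$ where $\alpha_i$ runs over all finite open covers of $X_i$, $1\le i\le k$. Small boundary property: for a dynamical system $(X,T)$ and $E\subset X$, the orbit capacity of $E$ is $$\mathrm{ocap}(E)=\lim_{n\to\infty}\sup_{x\in X}\frac1n\sum_{i=0}^{n-1}1_E(T^ix),$$ and $E$ is called small if $\mathrm{ocap}(E)=0$. The system $(X,T)$ has the small boundary property (SBP) if for every point $x\in X$ and every open set $U\ni x$ there is a neighborhood $V\subset U$ of $x$ whose boundary is small. *)

(* Defs.v *)
From mathcomp Require Import all_boot all_order all_algebra archimedean.
From mathcomp Require Import all_classical all_reals all_analysis.
From mathcomp Require Import lra.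

Set Implicit Arguments.
Unset Strict Implicit.
Unset Printing Implicit Defensive.

Import Order.TTheory GRing.Theory Num.Theory.
Import numFieldTopology.Exports numFieldNormedType.Exports.

Local Open Scope classical_set_scope.
Local Open Scope ring_scope.

(** A cover is a set of subsets, so its members are counted without
    multiplicity. *)

Definition finite_open_cover (X : topologicalType) (alpha : set (set X)) : Prop :=
  [/\ finite_set alpha,
      forall U, alpha U -> open U &
      \bigcup_(U in alpha) U = [set: X]].

Definition refines (X : Type) (beta alpha : set (set X)) : Prop :=
  forall V, beta V -> exists2 U, alpha U & V `<=` U.

(** [[set [set: X]]] is neutral for [cover_join]; it is the value of empty
    joins below. *)
Definition cover_join (X : Type) (alpha beta : set (set X)) : set (set X) :=
  [set U `&` V | U in alpha & V in beta].

Definition cover_preimage (X Y : Type) (f : X -> Y) (alpha : set (set Y)) :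
    set (set X) :=
  [set f @^-1` U | U in alpha].

(** The maximum and the minimum are written as [sup] and [inf] in [R]. For
    finite covers they are attained, the values being integers between -1 and
    the number of members of the cover. On the empty space [sup set0 = 0], so
    the order of any cover is -1. *)
Definition cover_ord (R : realType) (X : Type) (alpha : set (set X)) : R :=
  sup (range (fun x : X => \sum_(U \in alpha) (\1_U x : R))) - 1.

Definition cover_D (R : realType) (X : topologicalType) (alpha : set (set X)) : R :=
  inf [set cover_ord R beta |
       beta in [set beta | finite_open_cover beta /\ refines beta alpha]].

(** Indices are shifted by one with respect to the usual X_1, ..., X_k: the
    spaces are [X 0, ..., X k.-1], and [factor_comp pi i : X 0 -> X i] is
    tau_i = pi_i o ... o pi_1. A chain of [k] spaces is given as a sequence
    whose terms from rank [k] on play no role (any chain extends to one by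
    repeating its last space with the identity map). *)
Fixpoint factor_comp (X : nat -> Type) (pi : forall i, X i -> X i.+1) (i : nat) :
    X 0%N -> X i :=
  match i with
  | 0 => id
  | j.+1 => pi j \o factor_comp pi j
  end.

(** Join over [i < k] and [0 <= j < ceil ((a_0 + ... + a_i) n)] of
    T^(-j) (tau_i^(-1) alpha_i). The absolute value only turns a nonnegative
    [int] into a [nat]. *)
Definition weighted_join (R : realType) (k : nat) (a : nat -> R)
    (X : nat -> Type) (T : X 0%N -> X 0%N) (pi : forall i, X i -> X i.+1)
    (alpha : forall i, set (set (X i))) (n : nat) : set (set (X 0%N)) :=
  \big[@cover_join (X 0%N)/[set [set: X 0%N]]]_(i < k)
   \big[@cover_join (X 0%N)/[set [set: X 0%N]]]_(0 <= j <
       `|Num.ceil ((\sum_(l < i.+1) a l) * n%:R)|%N)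
     cover_preimage (iter j T) (cover_preimage (factor_comp pi i) (alpha i)).

Definition weighted_mdim (R : realType) (k : nat) (a : nat -> R)
    (X : nat -> topologicalType) (T : X 0%N -> X 0%N)
    (pi : forall i, X i -> X i.+1) : \bar R :=
  ereal_sup
    [set limn_esup
       (fun n : nat => (n%:R^-1 * cover_D R (weighted_join k a T pi alpha n))%:E)
    | alpha in [set alpha : forall i, set (set (X i)) |
                forall i, (i < k)%N -> finite_open_cover (alpha i)]].

Definition visit_freq (R : realType) (X : Type) (T : X -> X) (E : set X)
    (n : nat) (x : X) : R :=
  n%:R^-1 * \sum_(0 <= i < n) \1_E (iter i T x).

(** The limit always exists, see [is_cvg_ocap]. *)
Definition ocap (R : realType) (X : Type) (T : X -> X) (E : set X) : R :=
  limn (fun n => sup (range (visit_freq R T E n))).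

Definition is_small (R : realType) (X : Type) (T : X -> X) (E : set X) : Prop :=
  ocap R T E = 0.

Definition boundary (X : topologicalType) (V : set X) : set X :=
  closure V `\` interior V.

Definition small_boundary_property (R : realType) (X : topologicalType)
    (T : X -> X) : Prop :=
  forall (x : X) (U : set X), open U -> U x ->
    exists V : set X,
      [/\ nbhs x V, V `<=` U & is_small R T (boundary V)].

(** Fekete's lemma for nonnegative sequences. *)
Lemma is_cvg_fekete (R : realType) (v : nat -> R) :
  (forall n, 0 <= v n) ->
  (forall m n, (m + n)%:R * v (m + n)%N <= m%:R * v m + n%:R * v n) ->
  cvgn v.
Proof.
move=> v0 vD.
pose A := v @` [set n | (0 < n)%N].
have hA : has_inf A.
  split; first by exists (v 1%N), 1%N.
  by exists 0 => _ [n _ <-].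
apply/cvg_ex; exists (inf A); apply/cvgrPdist_le => e e0.
have e2 : 0 < e / 2 by lra.
have [_ [m /= m0 <-] vm] := inf_adherent e2 hA.
pose C := \sum_(r < m) (r%:R * v r).
have C0 : 0 <= C by apply: sumr_ge0 => r _; rewrite mulr_ge0.
have vq q : (q * m)%:R * v (q * m)%N <= (q * m)%:R * v m.
  elim: q => [|q IH]; first by rewrite mul0n !mul0r.
  by rewrite mulSn; apply: le_trans (vD _ _) _; rewrite natrD mulrDl lerD2l.
near=> n.
have n0 : (0 < n)%N by near: n; exists 1%N.
have nR : 0 < n%:R :> R by rewrite ltr0n.
have nC : C <= e / 2 * n%:R.
  rewrite mulrC -ler_pdivrMr //; near: n; exact: nbhs_infty_ger.
have lb : inf A <= v n by apply: ge_inf; [case: hA | exists n].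
have ub : v n <= v m + e / 2.
  rewrite -(ler_pM2l nR) mulrDr.
  rewrite [in X in X <= _](divn_eq n m); apply: le_trans (vD _ _) _.
  apply: lerD; last first.
    apply: le_trans (_ : C <= _); last by rewrite mulrC.
    rewrite /C (bigD1 (Ordinal (ltn_pmod n m0))) //= lerDl.
    by apply: sumr_ge0 => r _; rewrite mulr_ge0.
  apply: le_trans (vq _) _; apply: ler_wpM2r => //.
  by rewrite ler_nat leq_divM.
rewrite ler_norml; lra.
Unshelve. all: by end_near.
Qed.

Lemma is_cvg_ocap (R : realType) (X : Type) (T : X -> X) (E : set X) :
  cvgn (fun n => sup (range (visit_freq R T E n))).
Proof.
have ge0 n x : 0 <= visit_freq R T E n x.
  by rewrite mulr_ge0 ?invr_ge0 ?ler0n// sumr_ge0// => i _; rewrite indicE.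
have le1 n x : visit_freq R T E n x <= 1.
  have [->|n0] := posnP n; first by rewrite /visit_freq invr0 mul0r.
  rewrite /visit_freq mulrC ler_pdivrMr ?ltr0n// mul1r.
  apply: le_trans (_ : \sum_(0 <= i < n) 1 <= _); last first.
    by rewrite sumr_const_nat subn0.
  by apply: ler_sum => i _; rewrite indicE lern1 leq_b1.
have ub n : has_ubound (range (visit_freq R T E n)).
  by exists 1 => _ [x _ <-].
have range0 p : ~ (exists x : X, True) -> range (visit_freq R T E p) = set0.
  by move=> X0; apply/seteqP; split => // y [x _ _]; apply: X0; exists x.
have sup_ge0 n : 0 <= sup (range (visit_freq R T E n)).
  have [[x _]|/range0->] := pselect (exists x : X, True); last by rewrite sup0.
  by apply: le_trans (ge0 n x) _; apply: ub_le_sup => //; exists x.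
apply: is_cvg_fekete => // m n.
have [[x0 _]|X0] := pselect (exists x : X, True); last first.
  by rewrite !range0// sup0 !mulr0 addr0.
have [/eqP|mn0] := posnP (m + n)%N.
  by rewrite addn_eq0 => /andP[/eqP-> /eqP->]; rewrite addn0 !mul0r addr0.
rewrite mulrC -ler_pdivlMr ?ltr0n//.
apply: ge_sup; first by exists (visit_freq R T E (m + n) x0), x0.
move=> _ [x _ <-]; rewrite ler_pdivlMr ?ltr0n//.
have visitE p y : p%:R * visit_freq R T E p y = \sum_(0 <= i < p) \1_E (iter i T y).
  have [->|p0] := posnP p; first by rewrite mul0r big_geq.
  by rewrite /visit_freq mulVKf// pnatr_eq0 -lt0n.
rewrite mulrC visitE (@big_cat_nat _ _ _ m)//= ?leq_addr// -visitE.
have -> : \sum_(m <= i < m + n) \1_E (iter i T x) =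
          \sum_(0 <= i < n) \1_E (iter i T (iter m T x)) :> R.
  by rewrite -{1}[m]add0n big_addn addKn; apply: eq_bigr => i _; rewrite iterD.
rewrite -visitE; apply: lerD; apply: ler_wpM2l => //; exact: ub_le_sup.
Qed.

(* Main.v *)
Require Import Defs.
From mathcomp Require Import all_boot all_order all_algebra.
From mathcomp Require Import all_classical all_reals all_analysis.
From mathcomp Require Import archimedean finmap lra.

Import Order.TTheory GRing.Theory Num.Theory.
Import numFieldTopology.Exports numFieldNormedType.Exports.
Local Open Scope classical_set_scope.
Local Open Scope ring_scope.

(** Pulling everything back to the first space, it suffices to refine the join
    of [T^-i gamma] over [i < N], for one open cover [gamma], by an open cover
    of order at most [e * N]. By the small boundary property, [X] is covered by
    the interiors of finitely many [V_j], each with small boundary and with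
    closure in some [U_j] inside a member of [gamma]. For [i < N], the point
    [T^i x] lies in the interior of [V_j], or outside its closure, or near its
    boundary, where a continuous function [u_(i,j)] is positive; smallness of
    the boundaries bounds by [e * N] the number of pairs [(i, j)] of the last
    kind. Points are sorted according to a set of undecided pairs, on which
    [u] exceeds its values elsewhere, and to the side of [V_j] chosen for each
    other pair. Two such open pieces with the same number of undecided pairs
    are disjoint, so a point lies in at most one piece for each number from 0
    to [e * N]. This replaces dimension theory of polyhedra. *)

(** * Order of a cover, counted point by point *)

Lemma cover_ord_le (R : realType) (X : Type) (beta : set (set X)) (d : nat) :
  finite_set beta ->
  (forall x, exists2 s : seq (set X), (size s <= d.+1)%N &
     forall U, beta U -> U x -> U \in s) ->
  cover_ord R beta <= d%:R.
Proof.
move=> fb H; rewrite /cover_ord lerBlDr natr1.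
have [[x0 _]|X0] := pselect (exists x : X, True); last first.
  (* On the empty space the supremum is [sup set0 = 0]. *)
  have -> (g : X -> R) : range g = set0.
    by apply/seteqP; split => // y [x _ _]; apply: X0; exists x.
  by rewrite sup0 ler0n.
apply: ge_sup; first by exists (\sum_(U \in beta) (\1_U x0 : R)), x0.
move=> _ [x _ <-]; have [s ss sP] := H x.
rewrite fsbig_finite//= (eq_bigr (fun U => (x \in U : nat)%:R : R)); last first.
  by move=> U _; rewrite indicE.
rewrite -natr_sum ler_nat; apply: leq_trans ss.
rewrite -big_mkcond/= sum1_count -size_filter.
apply: uniq_leq_size; first by rewrite filter_uniq// finmap.fset_uniq.
move=> U; rewrite mem_filter => /andP[/set_mem Ux].
by rewrite in_fset_set// => /set_mem bU; exact: sP.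
Qed.

(** * Open pieces sorted by undecided indices *)

Section separation_pieces.
Context {R : realType} {X : topologicalType} {I : finType}.
Variables (u : I -> X -> R) (P Q : I -> set X).

Definition undecided (s : {ffun I -> option bool}) : {set I} :=
  [set t | s t == None]%SET.

(** As with open stars in a barycentric subdivision, the second clause makes the undecided indices
    the ones with the largest values of [u]; its strictness keeps pieces open. *)
Definition piece (s : {ffun I -> option bool}) : set X :=
  [set x | (forall t, match s t with
                      | None => 0 < u t x
                      | Some true => P t x
                      | Some false => Q t x
                      end) /\
           (forall t t', t \in undecided s -> t' \notin undecided s ->
              u t' x < u t x)].

Hypothesis PQ0 : forall t, P t `&` Q t = set0.

(* If the undecided sets of [s] and [s'] had the same size without being equal,
   [x] would have [u t' x < u t x < u t' x] for some [t] and [t'] in their two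
   differences. *)
Lemma piece_inj x s s' :
  #|undecided s| = #|undecided s'| -> piece s x -> piece s' x -> s = s'.
Proof.
move=> ss' [sx ux] [s'x u'x].
have ess' : undecided s = undecided s'.
  apply/eqP; rewrite eqEcard ss' leqnn andbT.
  apply/negPn/negP => /fintype.subsetPn[t ts ts'].
  have : ~~ (undecided s' \subset undecided s).
    apply/negP => sub; move: ts'; suff -> : undecided s' = undecided s by rewrite ts.
    by apply/eqP; rewrite eqEcard sub ss' leqnn.
  move=> /fintype.subsetPn[t' t's' t's].
  by have := lt_trans (ux _ _ ts t's) (u'x _ _ t's' ts'); rewrite ltxx.
apply/ffunP => t.
have : (t \in undecided s) = (t \in undecided s') by rewrite ess'.
rewrite !inE; move: (sx t) (s'x t) (PQ0 t).
case: (s t) => [[]|]; case: (s' t) => [[]|] // p q /seteqP[+ _] _ => /(_ x).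
  by case.
by case.
Qed.

Hypotheses (cu : forall t, continuous (u t)) (oP : forall t, open (P t))
  (oQ : forall t, open (Q t)).

Lemma open_piece s : open (piece s).
Proof.
rewrite openE => x [sx ux]; near=> y; split.
  near: y; apply: filter_forall => t; move: (sx t).
  case: (s t) => [[]|].
  - by move=> Ptx; apply: open_nbhs_nbhs; split.
  - by move=> Qtx; apply: open_nbhs_nbhs; split.
  - by move=> tx; exact: (cvgr_gt _ (cu t x)).
near: y; apply: filter_forall => t; apply: filter_forall => t'.
have [ts|ts] := boolP (t \in undecided s); last by near=> y.
have [t's|t's] := boolP (t' \in undecided s); first by near=> y.
have tt' := ux _ _ ts t's; pose m := (u t x + u t' x) / 2.
near=> y => _ _; apply: (@lt_trans _ _ m); near: y.
  by apply: (cvgr_lt _ (cu t' x)); rewrite /m; lra.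
by apply: (cvgr_gt _ (cu t x)); rewrite /m; lra.
Unshelve. all: by end_near. Qed.

Lemma skeleton_cover d :
  (forall t x, u t x <= 0 -> P t x \/ Q t x) ->
  (forall x, (#|[set t | (0 < u t x)%R]%SET| <= d)%N) ->
  exists beta : set (set X), [/\ finite_open_cover beta, cover_ord R beta <= d%:R &
    forall W, beta W -> W !=set0 /\
      forall t, [\/ W `<=` [set x | 0 < u t x], W `<=` P t | W `<=` Q t]].
Proof.
move=> uPQ ud.
(* Empty pieces are discarded so that each member of the cover has a point, which later excludes a
   wrong side. *)
pose D := [set s | (#|undecided s| <= d)%N /\ piece s !=set0].
exists (piece @` D); split; last 1 first.
- move=> _ [s [sd s0] <-]; split => // t.
  case E : (s t) => [[]|].
  + by constructor 2 => x [/(_ t)]; rewrite E.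
  + by constructor 3 => x [/(_ t)]; rewrite E.
  + by constructor 1 => x [/(_ t)]; rewrite E.
- split.
  + by apply: finite_image; exact: finite_finset.
  + by move=> _ [s _ <-]; exact: open_piece.
  + apply/seteqP; split => // x _.
    (* The undecided indices are those where [u] is positive, so they dominate the others, where
       [u <= 0] and [uPQ] supplies a side. *)
    pose s := [ffun t => if 0 < u t x then None else Some (x \in P t)].
    have us : undecided s = [set t | (0 < u t x)%R]%SET.
      by apply/setP => t; rewrite !inE ffunE; case: ifP.
    have sx : piece s x.
      split=> [t|t t'].
        rewrite ffunE; case: ltP => // /uPQ PQ.
        have [/set_mem//|/negP xP] := boolP (x \in P t).
        by case: PQ => // /mem_set.
      by rewrite us !inE -leNgt => ut ut'; apply: le_lt_trans ut.
    exists (piece s) => //; exists s => //; split; last by exists x.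
    by rewrite us.
- apply: cover_ord_le; first by apply: finite_image; exact: finite_finset.
  move=> x.
  (* [f r] picks the piece through [x] with [r] undecided indices, unique by [piece_inj]; the
     default, used when there is none, only adds a harmless entry to the list. *)
  pose f r := odflt [ffun=> None] [pick s | (#|undecided s| == r) && `[<piece s x>]].
  exists [seq piece (f r) | r <- iota 0 d.+1]; first by rewrite size_map size_iota.
  move=> _ [s [sd s0] <-] sx; apply/mapP; exists #|undecided s|.
    by rewrite mem_iota.
  congr piece; rewrite /f; case: pickP => [s' /andP[/eqP + /asboolP s'x]|].
    by move=> E; apply: (piece_inj x).
  by move/(_ s); rewrite eqxx/=; case: asboolP.
Qed.

End separation_pieces.

(** * Closed sets as zero sets *)

Lemma closed_zero_set (R : realType) (X : metricType R) (E : set X) : closed E ->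
  exists f : X -> R, [/\ continuous f, forall x, 0 <= f x & forall x, f x = 0 <-> E x].
Proof.
move=> cE; have [E0|/set0P[a Ea]] := eqVneq E set0.
  (* The distance to the empty set is infinite, so a constant replaces it. *)
  exists (fun=> 1); split => // [|x].
    by move=> x; exact: cvg_cst.
  by rewrite E0; split => // /eqP; rewrite oner_eq0.
have fin x : edist_inf E x \is a fin_num.
  have le_xa : (edist_inf E x <= edist (x, a))%E.
    by apply: ereal_inf_lbound; exists a.
  rewrite ge0_fin_numE ?edist_inf_ge0//; apply: le_lt_trans le_xa _.
  rewrite -ge0_fin_numE ?edist_ge0//; apply/edist_finP; exists (mdist x a + 1) => /=.
    by rewrite ltr_wpDl ?mdist_ge0.
  by rewrite ballEmdist/= ltrDl.
(* The distance to [E] is finite because [a] is in [E], and vanishes only on [E] because [E] is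
   closed. *)
exists (fine \o edist_inf E); split => [x|x|x].
- by apply: fine_cvg; rewrite fineK//; exact: edist_inf_continuous.
- by rewrite /= fine_ge0// edist_inf_ge0.
- split => [/= fx|Ex]; last by rewrite /= edist_inf0.
  have {}fx : edist_inf E x = 0%E by rewrite -(fineK (fin x)) fx.
  apply: cE => B /nbhs_ballP[e /= e0 eB].
  have := @lb_ereal_inf_adherent R _ e e0 (fin x).
  rewrite -[ereal_inf _]/(edist_inf E x) fx add0e => -[_ [b Eb <-] be].
  by exists b; split => //; apply: eB; exact: (edist_lt_ball be).
Qed.

Lemma continuous_iter (X : topologicalType) (T : X -> X) n :
  continuous T -> continuous (iter n T).
Proof.
move=> cT; elim: n => [|n IH] x; first exact: cvg_id.
by apply: continuous_comp; [exact: IH | exact: cT].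
Qed.

(** * Visits of orbits to a set *)

Section visits.
Context {R : realType} {X : Type} (T : X -> X).

Definition visits (G : set X) (n : nat) (x : X) : R :=
  \sum_(0 <= i < n) \1_G (iter i T x).

Lemma visits_le G n x : visits G n x <= n%:R.
Proof.
apply: le_trans (_ : \sum_(0 <= i < n) 1 <= _); last first.
  by rewrite sumr_const_nat subn0.
by apply: ler_sum => i _; rewrite indicE lern1 leq_b1.
Qed.

Lemma visitsD G m n x :
  visits G (m + n) x = visits G m x + visits G n (iter m T x).
Proof.
rewrite /visits (@big_cat_nat _ _ _ m)//= ?leq_addr//; congr (_ + _).
by rewrite -{1}[m]add0n big_addn addKn; apply: eq_bigr => i _; rewrite iterD.
Qed.

Lemma visits_le_linear G n e : (0 < n)%N -> 0 <= e ->
  (forall x, visits G n x <= e * n%:R) ->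
  forall N x, visits G N x <= e * N%:R + n%:R.
Proof.
move=> n0 e0 H N; have [m] := ubnP N; elim: m N => // m IH N Nm x.
have [Nn|nN] := ltnP N n.
  apply: le_trans (visits_le _ _ _) _; apply: le_trans (_ : n%:R <= _).
    by rewrite ler_nat ltnW.
  by rewrite lerDr mulr_ge0.
rewrite -(subnKC nN) visitsD natrD mulrDr -addrA; apply: lerD => //.
apply: IH; apply: (@leq_trans N); last by rewrite -ltnS.
by rewrite ltn_subrL n0 (leq_trans n0).
Qed.

Lemma visits_le_freq G n x : visits G n x <= n%:R * sup (range (visit_freq R T G n)).
Proof.
have [->|n0] := posnP n; first by rewrite /visits big_geq// mul0r.
rewrite -ler_pdivrMl ?ltr0n//; apply: ub_le_sup; last by exists x.
exists 1 => _ [y _ <-]; rewrite /visit_freq ler_pdivrMl ?ltr0n// mulr1.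
exact: visits_le.
Qed.

End visits.

(** At a fixed time [n], the visits to [f < r] from points near [x] are at most those to [f = 0]
    from [x], once [r] is small; compactness makes [r] uniform, and cutting into blocks passes from
    [n] to all large [N]. *)
Lemma visits_near_small (R : realType) (X : topologicalType) (T : X -> X)
    (f : X -> R) (e : R) :
  compact [set: X] -> continuous T -> continuous f -> (forall x, 0 <= f x) ->
  is_small R T [set x | f x = 0] -> 0 < e ->
  \forall r \near 0^'+, \forall N \near \oo, forall x,
    visits T [set y | f y < r] N x <= e * N%:R.
Proof.
move=> cX cT cf f0 sm e0.
have := @is_cvg_ocap R X T [set x | f x = 0].
rewrite /is_small /ocap in sm; move/cvg_ex => [l vl].
have l0 : l = 0 by rewrite -sm; apply/esym/cvg_lim.
rewrite {}l0 in vl; have e2 : 0 < e / 2 by lra.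
(* Half of [e] is spent here; the other half absorbs the remainder [n] of the block
   decomposition. *)
have [n n0 vn] : exists2 n, (0 < n)%N &
    forall x, visits T [set x | f x = 0] n x <= e / 2 * n%:R.
  have vle := (cvgrPdist_le _ _).1 vl _ e2.
  near \oo => n.
  exists n; first by near: n; exists 1%N.
  move=> x; apply: le_trans (visits_le_freq _ _ _ _) _.
  rewrite mulrC ler_wpM2r//; apply: le_trans (ler_norm _) _.
  by rewrite -normrN -sub0r; near: n; exact: vle.
have : \forall r \near 0^'+, [set: X] `<=`
    [set x | visits T [set y | f y < r] n x <= e / 2 * n%:R].
  apply: ((compact_near_coveringP _).1 cX) => x _.
  have nx (i : 'I_n) : \forall x' \near x & r \near 0^'+,
     (\1_[set y | f y < r] (iter i T x') : R) <= \1_[set y | f y = 0] (iter i T x).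
    have [fx|/eqP fx] := pselect (f (iter i T x) = 0).
      by near=> z; rewrite [leRHS]indicE mem_set// indicE lern1 leq_b1.
    have {}fx : 0 < f (iter i T x) by rewrite lt_def fx f0.
    have ci : continuous (f \o iter i T).
      by move=> y; apply: continuous_comp; [exact: continuous_iter|exact: cf].
    near=> x' r.
    suff rx' : ~ (f (iter i T x') < r).
      by rewrite [leLHS]indicE memNset//= indicE ler0n.
    apply/negP; rewrite -leNgt; apply: (@le_trans _ _ (f (iter i T x) / 2)).
      by near: r; apply: nbhs_right_le; lra.
    near: x'; apply: (cvgr_ge _ (ci x)); rewrite /=; lra.
  have := @filter_forall _ _ (fun (i : 'I_n) (z : X * R) =>
    (\1_[set y | f y < z.2] (iter i T z.1) : R) <= \1_[set y | f y = 0] (iter i T x))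
    _ _ nx.
  case=> [[A B] [Ax B0] AB]; exists (A, B) => // -[x' r] /AB /= x'r.
  apply: le_trans (vn x).
  by rewrite /visits !big_mkord; apply: ler_sum => i _; exact: x'r.
apply: filterS => r Hr.
near=> N => x.
apply: le_trans (visits_le_linear T _ n (e / 2) n0 _ _ N x) _ => //.
- exact: ltW.
- by move=> y; exact: Hr.
have : 2 * n%:R / e <= N%:R by near: N; exact: nbhs_infty_ger.
rewrite ler_pdivrMr// => ?; lra.
Unshelve. all: by end_near. Qed.

(** * Refining many iterates at once *)

Lemma closed_boundary (X : topologicalType) (V : set X) : closed (boundary V).
Proof.
apply: closedI; first exact: closed_closure.
by apply: open_closedC; exact: open_interior.
Qed.

Lemma card_visits (R : realType) (X : Type) (T : X -> X) (J : finType)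
    (G : J -> set X) (N : nat) x :
  #|[set t : 'I_N * J | iter t.1 T x \in G t.2]%SET|%:R =
  \sum_(j : J) visits T (G j) N x :> R.
Proof.
rewrite -sum1_card natr_sum big_mkcond/=.
under [RHS]eq_bigr do rewrite /visits big_mkord.
rewrite exchange_big pair_bigA/=; apply: eq_bigr => t _.
by rewrite inE indicE; case: ifP.
Qed.

Lemma compact_finite_subcover (X : topologicalType) (V : X -> set X) :
  compact [set: X] -> (forall x, nbhs x (V x)) ->
  exists D : {fset X}, forall x, exists2 p, p \in D & V p x.
Proof.
move=> cX nV.
(* Finite sets are filtered by inclusion, so that near-covering compactness yields one finite set
   good at every point. *)
pose F := filter_from setT (fun A : {fset X} => [set B | A `<=` B]%fset).
have FF : Filter F.
  apply: filter_from_filter => [|A B _ _]; first by exists fset0.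
  by exists (A `|` B)%fset => // C /=; rewrite fsubUset => /andP[].
have [] := (compact_near_coveringP _).1 cX _ F
    (fun D x => exists2 p, p \in D & V p x) FF.
  move=> x _; exists (V x, [set B | [fset x] `<=` B]%fset).
    by split; [exact: nV | exists [fset x]%fset].
  by move=> [y D] [/= Vxy]; rewrite fsub1set => xD; exists x.
by move=> D _ DV; exists D => x; apply: (DV D) => //=; exact: fsubset_refl.
Qed.

(** [Q] is kept abstract so that it can ask [U] to lie in members of all the pulled-back covers at
    once. *)
Lemma iterate_covers (R : realType) (X : metricType R) (T : X -> X)
    (Q : set X -> Prop) (e : R) :
  compact [set: X] -> continuous T -> small_boundary_property R T ->
  (forall x, exists2 U, open_nbhs x U & Q U) -> 0 < e ->
  \forall N \near \oo, exists beta : set (set X),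
    [/\ finite_open_cover beta, cover_ord R beta <= e * N%:R &
        forall W i, beta W -> (i < N)%N -> exists2 U, Q U & W `<=` iter i T @^-1` U].
Proof.
move=> cX cT sbp HQ e0.
have exVU (x : X) : exists VU : set X * set X,
    [/\ nbhs x VU.1, closure VU.1 `<=` VU.2, open VU.2, Q VU.2
      & is_small R T (boundary VU.1)].
  have [U [oU Ux] QU] := HQ x.
  (* Regularity shrinks [U] first, so that even the closure of the neighborhood with small boundary
     stays in [U]. *)
  have [B nB BU] := @uniform_regular X x U (open_nbhs_nbhs (conj oU Ux)).
  have [|V [nV VB sV]] := sbp x (interior B) (open_interior B).
    exact: nbhs_singleton (nbhs_interior nB).
  exists (V, U); split => //=; apply: subset_trans BU.
  by apply: closureS; apply: subset_trans VB (@interior_subset _ _).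
have [VU HVU] := choice exVU.
pose V x := (VU x).1; pose U x := (VU x).2.
have [D Dcov] : exists D : {fset X}, forall x, exists2 p, p \in D & interior (V p) x.
  apply: compact_finite_subcover => // x; apply: nbhs_interior.
  by have [] := HVU x.
have [f Hf] := choice (fun j : D =>
  closed_zero_set R X _ (closed_boundary _ (V (val j)))).
have clU (j : D) : closed (~` U (val j)).
  by apply: open_closedC; have [] := HVU (val j).
have [g Hg] := choice (fun j : D => closed_zero_set R X _ (clU j)).
pose c : R := #|{: D}|%:R.
have c0 : 0 <= c by exact: ler0n.
(* Summing over the [c] sets gives [c * e' <= e]; the [+ 1] covers the case [c = 0]. *)
pose e' := e / (c + 1).
have e'0 : 0 < e' by rewrite divr_gt0//; lra.
have visits_small : \forall r \near 0^'+, forall j : D, \forall N \near \oo, forall x,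
    visits T [set y | f j y < r] N x <= e' * N%:R.
  apply: filter_forall => j; have [fc fge0 f0] := Hf j.
  apply: (visits_near_small _ _ _ (f j)) => //.
  rewrite (_ : [set x | _] = boundary (V (val j))); first by have [] := HVU (val j).
  by apply/seteqP; split => x /f0.
near (0 : R)^'+ => r.
have r0 : 0 < r by near: r; exact: nbhs_right_gt.
have vr : forall j : D, \forall N \near \oo, forall x,
    visits T [set y | f j y < r] N x <= e' * N%:R.
  by near: r; exact: visits_small.
have vrN : \forall N \near \oo, forall j x,
    visits T [set y | f j y < r] N x <= e' * N%:R.
  exact: filter_forall.
apply: filterS vrN => N vN.
(* [f j] vanishes exactly on the boundary of [V j] and [g j] exactly off [U j]: the first term
   detects points near the boundary, the second keeps undecided points in [U j]. *)
pose u (t : 'I_N * D) x := Num.min (r - f t.2 (iter t.1 T x)) (g t.2 (iter t.1 T x)).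
pose P (t : 'I_N * D) := iter t.1 T @^-1` interior (V (val t.2)).
pose Q' (t : 'I_N * D) := iter t.1 T @^-1` (~` closure (V (val t.2))).
have [||||||beta [bcov bord bW]] :=
    @skeleton_cover R X _ u P Q' _ _ _ _ (Num.truncn (e * N%:R)).
- move=> t; apply/seteqP; split => // x [VTx]; apply; apply: subset_closure.
  exact: interior_subset.
- have ci h i : continuous h -> continuous (h \o iter i T : X -> R).
    by move=> ch y; apply: continuous_comp; [exact: continuous_iter|exact: ch].
  move=> [i j] x; have [fc _ _] := Hf j; have [gc _ _] := Hg j.
  apply: (@continuous_min R X (fun x => r - (f j \o iter i T) x)
    (g j \o iter i T)); last exact: (ci (g j)).
  by apply: cvgB; [exact: cvg_cst|exact: (ci (f j))].
- move=> t; apply: open_comp => [x _|]; [exact: continuous_iter|exact: open_interior].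
- move=> t; apply: open_comp => [x _|]; first exact: continuous_iter.
  by apply: closed_openC; exact: closed_closure.
- move=> [i j] x ux; set y := iter i T x.
  have [Vy|nVy] := pselect (interior (V (val j)) y); first by left.
  (* A point of the closure outside the interior is on the boundary, hence in [U j], and both terms
     of [u] are positive there. *)
  right => Vy; move: ux; rewrite leNgt => /negP; apply.
  have [_ _ f0] := Hf j; have [_ gge0 g0] := Hg j.
  rewrite /u /= -/y (f0 y).2 // subr0 lt_min r0/= lt_def gge0 andbT.
  apply/eqP => /g0; apply; have [_ + _ _ _] := HVU (val j); exact.
- move=> x; rewrite Num.Theory.truncn_ge_nat; last by rewrite mulr_ge0// ltW.
  apply: le_trans (_ : \sum_(j : D) visits T [set y | f j y < r] N x <= _).
    rewrite -card_visits ler_nat; apply: subset_leq_card; apply/fintype.subsetP => t.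
    by rewrite !inE mem_setE /u lt_min subr_gt0 => /andP[].
  apply: le_trans (_ : \sum_(j : D) e' * N%:R <= _).
    by apply: ler_sum => j _; exact: vN.
  rewrite sumr_const -[_ *+ _]mulr_natl -[_%:R]/c mulrA; apply: ler_wpM2r => //.
  by rewrite /e' mulrCA ger_pMr// ler_pdivrMr; lra.
exists beta; split => //.
  by apply: le_trans bord _; rewrite Num.Theory.truncn_le mulr_ge0// ltW.
move=> W i /bW[[x0 Wx0] {}bW] iN.
(* [p] is chosen at a single point of [W]. As the iterate of [x0] is interior to [V p], the outer
   side is impossible, and both other cases send all of [W] into [U p]. *)
have [p Dp Vp] := Dcov (iter i T x0).
pose j : D := FSetSub Dp; exists (U p); first by have [] := HVU p.
have [_ VU' _ _ _] := HVU p; have [_ _ g0] := Hg j.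
case: (bW (Ordinal iN, j)) => Wsub x /Wsub.
- rewrite /u /= lt_min => /andP[_]; apply: contraPP => /g0 ->; rewrite ltxx.
  exact.
- by move=> /interior_subset/subset_closure; exact: VU'.
- have := Wsub _ Wx0; rewrite /Q'/=; case; apply: subset_closure.
  exact: interior_subset.
Unshelve. all: by end_near. Qed.

(** * Refinements of joins and bounds on [cover_D] *)

Lemma refines_cover_join (X : Type) (beta alpha1 alpha2 : set (set X)) :
  refines beta alpha1 -> refines beta alpha2 -> refines beta (cover_join alpha1 alpha2).
Proof.
move=> r1 r2 W bW; have [U1 aU1 WU1] := r1 W bW; have [U2 aU2 WU2] := r2 W bW.
by exists (U1 `&` U2); [exists U1 => //; exists U2 | rewrite subsetI].
Qed.

Lemma refines_bigjoin (X : Type) (I : Type) (r : seq I) (P : pred I)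
    (beta : set (set X)) (F : I -> set (set X)) :
  (forall i, P i -> refines beta (F i)) ->
  refines beta (\big[@cover_join X/[set [set: X]]]_(i <- r | P i) F i).
Proof.
move=> bF; apply: (big_ind (refines beta)) => //.
  by move=> W _; exists setT.
exact: refines_cover_join.
Qed.

Lemma cover_ord_geN1 (R : realType) (X : Type) (beta : set (set X)) :
  -1 <= cover_ord R beta.
Proof.
rewrite /cover_ord lerBrDr addNr.
have sup_ge0 (A : set R) : (forall y, A y -> 0 <= y) -> 0 <= sup A.
  move=> A0; have [[[y Ay] ubA]|nA] := pselect (has_sup A); last by rewrite sup_out.
  exact: le_trans (A0 _ Ay) (ub_le_sup ubA Ay).
by apply: sup_ge0 => _ [x _ <-]; apply: fsumr_ge0 => U _; rewrite indicE.
Qed.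

Lemma cover_D_le (R : realType) (X : topologicalType) (alpha beta : set (set X)) :
  finite_open_cover beta -> refines beta alpha -> cover_D R alpha <= cover_ord R beta.
Proof.
move=> fb ba; apply: ge_inf; last by exists beta.
by exists (-1) => _ [g _ <-]; exact: cover_ord_geN1.
Qed.

Lemma cover_D_geN1 (R : realType) (X : topologicalType) (alpha : set (set X)) :
  -1 <= cover_D R alpha.
Proof.
rewrite /cover_D; set A := [set _ | _ in _].
have A1 : lbound A (-1) by move=> _ [g _ <-]; exact: cover_ord_geN1.
have [A0|nA] := pselect (A !=set0); first exact: lb_le_inf.
(* Without any refinement the infimum is [inf set0 = 0]. *)
have -> : A = set0 by apply/seteqP; split => // y Ay; apply: nA; exists y.
by rewrite inf0 lerN10.
Qed.

Lemma absz_ceil_le (R : realType) (x y : R) : 0 <= x -> x <= y ->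
  (`|Num.ceil x| <= `|Num.ceil y|)%N.
Proof.
move=> x0 xy; have c0 (z : R) : 0 <= z -> 0 <= Num.ceil z.
  by move=> ?; rewrite ceil_ge0; lra.
by rewrite -lez_nat !gez0_abs ?c0 ?le_ceil//; exact: le_trans xy.
Qed.

Lemma absz_ceil_lt (R : realType) (x : R) : 0 <= x -> `|Num.ceil x|%N%:R < x + 1.
Proof.
move=> x0; rewrite natr_absz ger0_norm ?ceil_ge0; last by lra.
by have := ceilB1_lt x; rewrite intrB; lra.
Qed.

Lemma factor_comp_continuous (X : nat -> topologicalType)
    (pi : forall i, X i -> X i.+1) k :
  (forall i, (i.+1 < k)%N -> continuous (pi i)) ->
  forall i, (i < k)%N -> continuous (factor_comp pi i).
Proof.
move=> cpi; elim=> [|i IH] ik x; first exact: cvg_id.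
by apply: continuous_comp; [exact: IH (ltnW ik) x | exact: cpi ik _].
Qed.

(** * Weighted joins along the chain of factors *)

Theorem theorem1p5 (R : realType) (k : nat) (X : nat -> metricType R)
    (T : forall i, X i -> X i) (pi : forall i, X i -> X i.+1) (a : nat -> R)
    (k_ge2 : (2 <= k)%N)
    (X_compact : forall i, (i < k)%N -> compact [set: X i])
    (T_cont : forall i, (i < k)%N -> continuous (T i))
    (pi_cont : forall i, (i.+1 < k)%N -> continuous (pi i))
    (pi_equivariant : forall i, (i.+1 < k)%N ->
       forall x, pi i (T i x) = T i.+1 (pi i x))
    (a0_gt0 : 0 < a 0%N)
    (a_ge0 : forall i, (0 < i < k)%N -> 0 <= a i) :
  small_boundary_property R (T 0%N) -> weighted_mdim k a (T 0%N) pi = 0%E.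
Proof.
move=> sbp; have k0 : (0 < k)%N by exact: ltnW.
rewrite /weighted_mdim; set S := [set _ | _ in _].
have S0 y : S y -> y = 0%E.
  move=> [alpha /= calpha <-]; apply: (cvg_limn_einf_sup _).2.
  pose A := \sum_(l < k) a l.
  have a0 l : (l < k)%N -> 0 <= a l.
    by case: l => [_|l lk]; [exact: ltW | exact: a_ge0].
  have A0 : 0 <= A by apply: sumr_ge0 => l _; exact: a0.
  (* A set with [Q] lies in a member of the join of all the [alpha l] pulled back to the first
     space. *)
  pose Q (U : set (X 0%N)) := forall l, (l < k)%N ->
    exists2 B, alpha l B & U `<=` factor_comp pi l @^-1` B.
  have HQ x : exists2 U, open_nbhs x U & Q U.
    have exB (l : 'I_k) : exists B, alpha l B /\ B (factor_comp pi l x).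
      have [_ _] := calpha l (ltn_ord l).
      by move=> /seteqP[_ /(_ (factor_comp pi l x) I)] [B]; exists B.
    pose B l := projT1 (cid (exB l)); have HB l := projT2 (cid (exB l)).
    exists (interior (\bigcap_(l in [set: 'I_k]) (factor_comp pi l @^-1` B l))).
      split; first exact: open_interior.
      apply: (@filterS _ _ _ [set z | forall l : 'I_k, B l (factor_comp pi l z)]).
        by move=> z Bz l _; exact: Bz.
      apply: filter_forall => l; have [aB Bx] := HB l.
      apply: (factor_comp_continuous _ _ _ pi_cont _ (ltn_ord l)).
      have [_ oalpha _] := calpha l (ltn_ord l).
      by apply: open_nbhs_nbhs; split => //; exact: oalpha.
    move=> l lk; exists (B (Ordinal lk)); first by have [] := HB (Ordinal lk).
    by move=> z /interior_subset /(_ (Ordinal lk) I).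
  apply/fine_cvgP; split; first exact: nearW.
  apply/cvgrPdist_le => e e0; rewrite /comp/=.
  (* The [N] below is at most [(A + 1) * n], which turns [e / (A + 1) * N] into at most [e * n]. *)
  have e'0 : 0 < e / (A + 1) by rewrite divr_gt0//; lra.
  have [N0 _ HN] := iterate_covers R (X 0%N) (T 0%N) Q (e / (A + 1))
    (X_compact _ k0) (T_cont _ k0) sbp HQ e'0.
  near=> n.
  have n0 : 0 < n%:R :> R by rewrite ltr0n; near: n; exists 1%N.
  have n1e : e^-1 <= n%:R by near: n; exact: nbhs_infty_ger.
  have n1N : 1 + N0%:R <= n%:R :> R by near: n; exact: nbhs_infty_ger.
  have An0 : 0 <= A * n%:R by rewrite mulr_ge0.
  (* The first term covers every time range of the join, the partial sums of [a] being at most [A];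
     adding [N0] makes [HN] applicable. *)
  pose N := (`|Num.ceil (A * n%:R)| + N0)%N.
  have [beta [bcov bord bQ]] := HN N (leq_addl _ _).
  have bref : refines beta (weighted_join k a (T 0%N) pi alpha n).
    apply: refines_bigjoin => i _; rewrite big_mkord.
    apply: refines_bigjoin => j _ W bW.
    have jN : (j < N)%N.
      apply: leq_trans (ltn_ord j) _; apply: leq_trans (leq_addr _ _).
      apply: absz_ceil_le.
        rewrite mulr_ge0//; apply: sumr_ge0 => l _; apply: a0.
        exact: leq_trans (ltn_ord l) (ltn_ord i).
      apply: ler_wpM2r => //; rewrite /A (big_ord_widen _ a (ltn_ord i)).
      rewrite big_mkcond/=; apply: ler_sum => l _.
      by case: ifP => // _; exact: a0.
    have [U QU WU] := bQ W j bW jN; have [B aB UB] := QU i (ltn_ord i).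
    exists (iter j (T 0%N) @^-1` (factor_comp pi i @^-1` B)).
      by exists (factor_comp pi i @^-1` B) => //; exists B.
    by move=> x /WU /UB.
  have NA : N%:R <= (A + 1) * n%:R.
    by rewrite natrD; have := absz_ceil_lt _ _ An0; lra.
  have Dle : cover_D R (weighted_join k a (T 0%N) pi alpha n) <= e * n%:R.
    apply: le_trans (cover_D_le _ _ _ _ bcov bref) _; apply: le_trans bord _.
    rewrite mulrAC ler_pdivrMr; last by lra.
    by rewrite -mulrA ler_pM2l// [_ * (A + 1)]mulrC.
  have Dge := cover_D_geN1 R _ (weighted_join k a (T 0%N) pi alpha n).
  (* [cover_D] can be as low as -1; then [n >= 1 / e] keeps [-1 / n] above [-e]. *)
  rewrite sub0r normrN ler_norml ler_pdivrMl// [n%:R * e]mulrC Dle andbT.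
  rewrite ler_pdivlMl//; apply: le_trans Dge.
  by move: n1e; rewrite -[_^-1]mul1r ler_pdivrMr// => ?; lra.
rewrite (_ : S = [set 0%E]) ?ereal_sup1//; apply/seteqP; split => [y /S0 ->//|_ ->].
(* The supremum of an empty set would be [-oo]; the trivial covers provide an element. *)
have nS : S !=set0.
  exists (limn_esup (fun n => (n%:R^-1 * cover_D R (weighted_join k a (T 0%N) pi
    (fun i => [set [set: X i]]) n))%:E)).
  exists (fun i => [set [set: X i]]) => // i _; split.
  - exact: finite_set1.
  - by move=> U ->; exact: openT.
  - by rewrite bigcup_set1.
by have [y Sy] := nS; rewrite -(S0 _ Sy).
Unshelve. all: by end_near. Qed.
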